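(* Let $R$ be a one-dimensional Cohen–Macaulay local ring such that every regular ideal has a principal reduction. Then the following are equivalent: (1) $R$ is Arf; (2) every regular trace ideal of $R$ is stable.
   Context: An ideal is regular if it contains a nonzerodivisor. A principal reduction of an ideal $I$ is a principal ideal $(x)\subseteq I$ with $xI^n=I^{n+1}$ for some $n$. For an $R$-module $N$, $\operatorname{tr}(N)$ is the image of $N\otimes_R\operatorname{Hom}_R(N,R)\to R$, $n\otimes\alpha\mapsto\alpha(n)$; an ideal $I$ is a trace ideal if $I=\operatorname{tr}(N)$ for some $N$. $Q(R)$ is the total quotient ring. For a regular ideal $I$, $B_R(I)=\bigcup_{n>0}(I^n:_{Q(R)}I^n)$, and $I$ is stable if $B_R(I)=I:_{Q(R)}I$. $R$ is called Arf if every integrally closed regular ideal of $R$ is stable. *)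

(* Defs.v *)
From HB Require Import structures.
From mathcomp Require Import all_boot all_order all_algebra.
Set Implicit Arguments. Unset Strict Implicit. Unset Printing Implicit Defensive.
Import Order.TTheory GRing.Theory Num.Theory.
Local Open Scope ring_scope.

Section CommAlg.
Variable R : comNzRingType.

Definition is_ideal (I : R -> Prop) : Prop :=
  I 0 /\ (forall x y, I x -> I y -> I (x + y)) /\ (forall r x, I x -> I (r * x)).

Definition nonzerodivisor (x : R) : Prop := forall y : R, x * y = 0 -> y = 0.

Definition regular_ideal (I : R -> Prop) : Prop := exists x, I x /\ nonzerodivisor x.

Definition gen_by (s : seq R) (x : R) : Prop :=
  exists c : 'I_(size s) -> R, x = \sum_(i < size s) c i * s`_i.

Definition ideal_mul (J K : R -> Prop) (x : R) : Prop :=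
  exists s : seq (R * R), (forall p, p \in s -> J p.1 /\ K p.2) /\
    x = \sum_(p <- s) p.1 * p.2.

Fixpoint ipow (I : R -> Prop) (n : nat) : R -> Prop :=
  match n with
  | O => fun _ => True
  | S k => ideal_mul (ipow I k) I
  end.

Definition has_principal_reduction (I : R -> Prop) : Prop :=
  exists x, I x /\ exists n : nat,
    forall y, (exists z, ipow I n z /\ y = x * z) <-> ipow I n.+1 y.

Definition integral_over_ideal (I : R -> Prop) (x : R) : Prop :=
  exists n : nat, exists a : nat -> R, (0 < n)%N /\
    (forall i, (0 < i <= n)%N -> ipow I i (a i)) /\
    x ^+ n + \sum_(1 <= i < n.+1) a i * x ^+ (n - i) = 0.

Definition integrally_closed_ideal (I : R -> Prop) : Prop :=
  forall x, I x <-> integral_over_ideal I x.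

(* Elements of the total quotient ring Q(R) are written a/s with s a
   nonzerodivisor.  (a/s) ∈ (J :_{Q(R)} J) iff (a/s) J ⊆ J, i.e. for every
   x ∈ J there is y ∈ J with a x = s y (this is independent of the
   representative). *)
Definition colonQ (J : R -> Prop) (a s : R) : Prop :=
  forall x, J x -> exists y, J y /\ a * x = s * y.

(* I stable: B_R(I) = ⋃_{n>0} (I^n : I^n) equals I : I inside Q(R) *)
Definition stable (I : R -> Prop) : Prop :=
  forall a s : R, nonzerodivisor s ->
    ((exists n : nat, (0 < n)%N /\ colonQ (ipow I n) a s) <-> colonQ I a s).

Definition Arf : Prop :=
  forall I, is_ideal I -> integrally_closed_ideal I -> regular_ideal I -> stable I.

(* trace of a module N: image of N ⊗ Hom(N,R) -> R, i.e. finite sums of α(n) *)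
Definition trace_of (N : lmodType R) (r : R) : Prop :=
  exists s : seq (N * {linear N -> R^o}), r = \sum_(p <- s) (p.2 p.1 : R).

Definition trace_ideal (I : R -> Prop) : Prop :=
  exists N : lmodType R, forall r, I r <-> trace_of N r.

Definition prime_ideal (P : R -> Prop) : Prop :=
  is_ideal P /\ ~ P 1 /\ (forall a b, P (a * b) -> P a \/ P b).

Definition maximal_ideal (M : R -> Prop) : Prop :=
  is_ideal M /\ ~ M 1 /\
  (forall J, is_ideal J -> (forall x, M x -> J x) -> (forall x, J x <-> M x) \/ J 1).

Definition is_local : Prop :=
  exists m, maximal_ideal m /\ forall m', maximal_ideal m' -> forall x, m' x <-> m x.

Definition noetherian : Prop :=
  forall I, is_ideal I -> exists s : seq R, forall x, I x <-> gen_by s x.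

Definition prime_chain (d : nat) : Prop :=
  exists p : nat -> R -> Prop,
    (forall i, (i <= d)%N -> prime_ideal (p i)) /\
    (forall i, (i < d)%N -> (forall x, p i x -> p i.+1 x) /\ exists x, p i.+1 x /\ ~ p i x).

Definition krull_dim (d : nat) : Prop := prime_chain d /\ ~ prime_chain d.+1.

Definition regular_sequence (m : R -> Prop) (s : seq R) : Prop :=
  (forall i, (i < size s)%N -> m s`_i) /\
  (forall i, (i < size s)%N -> forall y,
     gen_by (take i s) (s`_i * y) -> gen_by (take i s) y) /\
  ~ gen_by s 1.

(* Cohen–Macaulay local ring: depth = dim, i.e. the maximal ideal contains
   a regular sequence of length dim R *)
Definition cohen_macaulay_local : Prop :=
  noetherian /\ is_local /\
  exists m, maximal_ideal m /\
    forall d, krull_dim d -> exists s, regular_sequence m s /\ size s = d.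

End CommAlg.

(* Main.v *)
(* For a regular ideal [I] with principal reduction [x], stability means
   [(y / x) I] is contained in [I] for all [y] in [I].

   Suppose regular trace ideals are stable, let [I] be integrally closed and
   [J = tr(I) = I (R : I)]. If [x I^n = I^(n+1)] then [y / x] maps [I^m] to
   itself for [m > n], hence also [J^m = I^m (R : I)^m], hence [J] by stability.
   Since [I] lies in [J], [(y / x) I] lies in [R]; its elements are integral
   over [I], so they are in [I].

   Conversely let [R] be Arf, [J] a trace ideal with principal reduction [x],
   and [K] the integral closure of [J], which is [x \bar{R} \cap R]. By
   stability [K K = w K] for some [w] in [K], and the integral equation of [w]
   over [(x)] yields [w K <= x K]. So for [y] in [J], [(y / x) J] lies in [K],
   hence in [R], and a trace ideal is preserved by every fraction that maps it
   into [R]. *)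
Require Import Defs.
From mathcomp Require Import all_boot all_order all_algebra.
From HB Require Import structures.
From mathcomp Require Import ring.
From mathcomp Require Import boolp.
Set Implicit Arguments. Unset Strict Implicit. Unset Printing Implicit Defensive.

(** * Products, powers and colons of ideals; principal reductions *)

Section IdealArithmetic.
Import GRing.Theory.
Local Open Scope ring_scope.
Variable R : comNzRingType.
Implicit Types (A B C D I J K M : R -> Prop) (a b r s x y z : R).

Lemma nonzerodivisor_cancel x a b : nonzerodivisor x -> x * a = x * b -> a = b.
Proof.
move=> hx e; apply/eqP; rewrite -subr_eq0; apply/eqP; apply: hx.
by rewrite mulrBr e subrr.
Qed.

Lemma nonzerodivisorM x y :
  nonzerodivisor x -> nonzerodivisor y -> nonzerodivisor (x * y).
Proof. by move=> hx hy z; rewrite -mulrA => /hx /hy. Qed.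

Lemma nonzerodivisorX x n : nonzerodivisor x -> nonzerodivisor (x ^+ n).
Proof.
move=> hx; elim: n => [|n IHn]; first by move=> y; rewrite expr0 mul1r.
by rewrite exprS; apply: nonzerodivisorM.
Qed.

Lemma nonzerodivisor_factor x y : nonzerodivisor (x * y) -> nonzerodivisor x.
Proof. by move=> hxy z xz0; apply: hxy; rewrite mulrAC xz0 mul0r. Qed.

Lemma ideal_sum A (hA : is_ideal A) (T : Type) (s : seq T) (P : pred T)
    (F : T -> R) :
  (forall i, P i -> A (F i)) -> A (\sum_(i <- s | P i) F i).
Proof.
by case: hA => A0 [AD _] AF; elim/big_ind: _ => // ? ? /AD h; apply: h.
Qed.

Lemma idealM A r x : is_ideal A -> A x -> A (r * x).
Proof. by case=> _ [_ AM]; apply: AM. Qed.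

Lemma idealN A x : is_ideal A -> A x -> A (- x).
Proof. by move=> hA; rewrite -mulN1r; apply: idealM. Qed.

(** For a nonzerodivisor [s], the elements that [r / s] maps into [A]; with [r = 1] this is the
    ideal [s A]. *)
Definition colon_preimage (A : R -> Prop) (r s t : R) : Prop :=
  exists y, A y /\ r * t = s * y.

Lemma colon_preimage_ideal A r s :
  is_ideal A -> is_ideal (colon_preimage A r s).
Proof.
move=> hA; have [A0 [AD _]] := hA; split; first by exists 0; rewrite !mulr0.
split=> [u v [y [Ay e]] [z [Az f]]|c u [y [Ay e]]].
  by exists (y + z); split; [exact: AD | rewrite !mulrDr e f].
by exists (c * y); split; [exact: idealM | rewrite mulrCA e mulrCA].
Qed.

(** Impredicative encoding: a containment of the span in an ideal is proved by applying membership
    to that ideal. *)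
Definition ideal_span (S : R -> Prop) (t : R) : Prop :=
  forall P : R -> Prop, is_ideal P -> (forall x, S x -> P x) -> P t.

Lemma ideal_span_ideal (S : R -> Prop) : is_ideal (ideal_span S).
Proof.
split; first by move=> P [].
split=> [x y Sx Sy P hP SP|r x Sx P hP SP].
  by have [_ [PD _]] := hP; apply: PD; [exact: Sx | exact: Sy].
by apply: idealM => //; apply: Sx.
Qed.

Lemma mem_ideal_span (S : R -> Prop) x : S x -> ideal_span S x.
Proof. by move=> Sx P _; apply. Qed.

Lemma ideal_mul_mem A B a b : A a -> B b -> ideal_mul A B (a * b).
Proof.
move=> Aa Bb; exists [:: (a, b)]; split; last by rewrite big_seq1.
by move=> p; rewrite inE => /eqP ->.
Qed.

Lemma ideal_mul_ind A B (P : R -> Prop) t :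
  P 0 -> (forall x y, P x -> P y -> P (x + y)) ->
  (forall a b, A a -> B b -> P (a * b)) ->
  ideal_mul A B t -> P t.
Proof.
move=> P0 PD PM [s [hs ->]]; rewrite big_seq; elim/big_ind: _ => //.
by move=> p /hs [? ?]; apply: PM.
Qed.

Lemma ideal_mulD A B x y :
  ideal_mul A B x -> ideal_mul A B y -> ideal_mul A B (x + y).
Proof.
move=> [s [hs ->]] [t [ht ->]]; exists (s ++ t); split; last by rewrite big_cat.
by move=> p; rewrite mem_cat => /orP[/hs|/ht].
Qed.

Lemma ideal_mul0 A B : ideal_mul A B 0.
Proof. by exists [::]; rewrite big_nil. Qed.

Lemma ideal_mul_ideal A B : is_ideal A -> is_ideal (ideal_mul A B).
Proof.
move=> hA; split; first exact: ideal_mul0.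
split=> [x y|r x]; first exact: ideal_mulD.
elim/ideal_mul_ind; first by rewrite mulr0; apply: ideal_mul0.
- by move=> u v hu hv; rewrite mulrDr; apply: ideal_mulD.
- by move=> a b Aa Bb; rewrite mulrA; apply: ideal_mul_mem => //; apply: idealM.
Qed.

Lemma ideal_mulACA A B C D t :
  ideal_mul (ideal_mul A B) (ideal_mul C D) t ->
  ideal_mul (ideal_mul A C) (ideal_mul B D) t.
Proof.
elim/ideal_mul_ind => [|x y|u v + hv]; [exact: ideal_mul0|exact: ideal_mulD|].
elim/ideal_mul_ind => [|x y hx hy|a b Aa Bb].
- by rewrite mul0r; apply: ideal_mul0.
- by rewrite mulrDl; apply: ideal_mulD.
move: hv; elim/ideal_mul_ind => [|x y hx hy|c d Cc Dd].
- by rewrite mulr0; apply: ideal_mul0.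
- by rewrite mulrDr; apply: ideal_mulD.
by rewrite mulrACA; apply: ideal_mul_mem; apply: ideal_mul_mem.
Qed.

Lemma ipow_ideal I n : is_ideal I -> is_ideal (ipow I n).
Proof. by move=> hI; elim: n => [|n IHn] //=; apply: ideal_mul_ideal. Qed.

Lemma ipowX I n x : I x -> ipow I n (x ^+ n).
Proof.
by move=> Ix; elim: n => [|n IHn] //=; rewrite exprSr; apply: ideal_mul_mem.
Qed.

Lemma ipow1 I x : is_ideal I -> ipow I 1 x <-> I x.
Proof.
move=> hI; split=> [|Ix]; last by rewrite -[x]mul1r; apply: ideal_mul_mem.
rewrite /=; elim/ideal_mul_ind => [||a b _]; [by case: hI|by case: hI => _ []|].
exact: idealM.
Qed.

Lemma colonQD A a b s : is_ideal A ->
  colonQ A a s -> colonQ A b s -> colonQ A (a + b) s.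
Proof.
move=> hA ha hb x Ax; have [y [Ay ey]] := ha x Ax; have [z [Az ez]] := hb x Ax.
exists (y + z); rewrite mulrDl mulrDr ey ez; split=> //.
by case: hA => _ [AD _]; apply: AD.
Qed.

Lemma colonQ_scale A a r s : is_ideal A -> colonQ A a s -> colonQ A (r * a) s.
Proof.
move=> hA ha x Ax; have [y [Ay e]] := ha x Ax.
by exists (r * y); split; [exact: idealM | rewrite -mulrA e mulrCA].
Qed.

Lemma colonQ0 A s : is_ideal A -> colonQ A 0 s.
Proof. by case=> A0 _ x _; exists 0; rewrite mul0r mulr0. Qed.

Lemma colonQM A a b s r : colonQ A a s -> colonQ A b r -> colonQ A (a * b) (s * r).
Proof.
move=> ha hb x Ax; have [y [Ay ey]] := hb x Ax; have [z [Az ez]] := ha y Ay.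
by exists z; split=> //; rewrite -mulrA ey mulrCA ez; ring.
Qed.

Lemma colonQ_mull A B a s : colonQ A a s -> colonQ (ideal_mul A B) a s.
Proof.
move=> ha x; elim/ideal_mul_ind => [|u v [y [hy ey]] [z [hz ez]]|u v Au Bv].
- by exists 0; rewrite !mulr0; split=> //; apply: ideal_mul0.
- by exists (y + z); rewrite !mulrDr ey ez; split=> //; apply: ideal_mulD.
have [y [Ay e]] := ha u Au.
by exists (y * v); rewrite !mulrA e; split=> //; apply: ideal_mul_mem.
Qed.

Lemma colonQ_mulr A B a s : colonQ B a s -> colonQ (ideal_mul A B) a s.
Proof.
move=> ha x; elim/ideal_mul_ind => [|u v [y [hy ey]] [z [hz ez]]|u v Au Bv].
- by exists 0; rewrite !mulr0; split=> //; apply: ideal_mul0.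
- by exists (y + z); rewrite !mulrDr ey ez; split=> //; apply: ideal_mulD.
have [y [By e]] := ha v Bv.
by exists (u * y); rewrite mulrCA e mulrCA; split=> //; apply: ideal_mul_mem.
Qed.

(* [r / x] is integral over [R], because it acts on the finitely generated
   module [M]: Cayley-Hamilton for the matrix of this action. *)
Lemma colonQ_integral_equation M x r :
  noetherian R -> is_ideal M -> regular_ideal M -> colonQ M r x ->
  exists n, exists c : nat -> R, (0 < n)%N /\
    r ^+ n + \sum_(1 <= i < n.+1) c i * x ^+ i * r ^+ (n - i) = 0.
Proof.
move=> noeth hM [g [Mg hg]] hrx.
have [s hs] := noeth M hM.
have Ms (i : 'I_(size s)) : M s`_i.
  apply/hs; exists (fun j => (j == i)%:R).
  rewrite (bigD1 i) //= eqxx mul1r big1 ?addr0 // => j /negPf ->.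
  by rewrite mul0r.
have [C hC] : exists C : 'I_(size s) -> 'I_(size s) -> R,
    forall i : 'I_(size s), r * s`_i = x * \sum_j C i j * s`_j.
  suff : forall i : 'I_(size s), exists c : 'I_(size s) -> R,
      r * s`_i = x * \sum_j c j * s`_j by move/fin_all_exists.
  by move=> i; have [y [/hs [c ->] e]] := hrx _ (Ms i); exists c.
have [c0 gE] := (hs g).1 Mg.
(* Square matrices form a ring only in positive size; an empty list of generators would give
   [g = 0]. *)
move: c0 gE C hC Ms; case: (size s) => [|k] c0 gE C hC Ms.
  have g0 : g = 0 by rewrite gE big_ord0.
  by have /eqP := hg 1 (etrans (congr1 ( *%R^~ 1) g0) (mul0r 1)); rewrite oner_eq0.
pose A : 'M[R]_k.+1 := \matrix_(i, j) C i j.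
pose v : 'cV[R]_k.+1 := \col_i s`_i.
have Av j : x ^+ j *: (A ^+ j *m v) = r ^+ j *: v.
  elim: j => [|j IHj]; first by rewrite !expr0 !scale1r mul1mx.
  have A1 : x *: (A *m v) = r *: v.
    apply/matrixP=> i l; rewrite !mxE hC; congr (_ * _).
    by apply: eq_bigr => m _; rewrite !mxE.
  rewrite exprSr [A ^+ j.+1]exprSr -mulmxE -mulmxA -scalerA scalemxAr A1.
  by rewrite -scalemxAr scalerA mulrC -scalerA IHj scalerA -exprS.
pose p := char_poly A.
have sp : size p = k.+2 by rewrite size_char_poly.
have pA : \sum_(i < k.+2) p`_i *: A ^+ i = 0.
  have := Cayley_Hamilton A; rewrite -/p -[X in horner_mx _ X]coefK poly_def sp.
  rewrite raddf_sum => {2}<-; apply: eq_bigr => i _.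
  by rewrite /= horner_mxZ rmorphXn /= horner_mx_X.
(* [x ^+ k.+1] times the value of the characteristic polynomial at [r / x]. It kills the generators
   of [M], hence the nonzerodivisor [g]. *)
pose e := \sum_(i < k.+2) p`_i * x ^+ (k.+1 - i) * r ^+ i.
have ev : e *: v = 0.
  transitivity (x ^+ k.+1 *: ((\sum_(i < k.+2) p`_i *: A ^+ i) *m v)); last first.
    by rewrite pA mul0mx scaler0.
  rewrite mulmx_suml scaler_sumr scaler_suml; apply: eq_bigr => i _.
  rewrite -scalerA -Av scalerA -scalemxAl scalerA -mulrA -exprD subnK //.
    by rewrite mulrC.
  by rewrite -ltnS.
have e0 : e = 0.
  apply: hg; rewrite gE mulr_suml big1 // => i _.
  rewrite -mulrA; have /matrixP /(_ i 0) := ev; rewrite !mxE mulrC => ->.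
  exact: mulr0.
exists k.+1, (fun i => p`_(k.+1 - i)); split=> //.
rewrite -[RHS]e0 /e big_ord_recr /= subnn expr0 mulr1 addrC.
have -> : p`_k.+1 = 1.
  by have /monicP := char_poly_monic A; rewrite /lead_coef -/p sp.
rewrite mul1r; congr (_ + _).
rewrite big_add1 /= big_nat_rev /= big_mkord; apply: eq_bigr => i _.
have -> : (0 + k.+1 - i.+1).+1 = (k.+1 - i)%N by rewrite add0n subSS subSn // -ltnS.
by rewrite subKn // ltnW.
Qed.

(** A regular [g] in [I] has [g ^+ n.+1] in [x I^n], so [x] divides a nonzerodivisor. *)
Lemma reduction_nonzerodivisor I x n :
  regular_ideal I ->
  (forall y, (exists z, ipow I n z /\ y = x * z) <-> ipow I n.+1 y) ->
  nonzerodivisor x.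
Proof.
move=> [g [Ig hg]] hx; have [z [_ e]] := (hx _).2 (ipowX n.+1 Ig).
by apply: (@nonzerodivisor_factor x z); rewrite -e; apply: nonzerodivisorX.
Qed.

Lemma reduction_colonQ I x n y :
  (forall y, (exists z, ipow I n z /\ y = x * z) <-> ipow I n.+1 y) ->
  I y -> colonQ (ipow I n.+1) y x.
Proof.
move=> hx Iy a /hx [z [hz ->]]; exists (z * y); rewrite mulrCA [y * z]mulrC.
by split=> //; apply: ideal_mul_mem.
Qed.

(** The last hypothesis says [I I = x I], so [I^(n+1) = x^n I]; a fraction preserving this ideal
    preserves [I], by cancelling [x^n]. *)
Lemma stable_of_reduction I x :
  is_ideal I -> I x -> nonzerodivisor x ->
  (forall y, I y -> colonQ I y x) -> stable I.
Proof.
move=> hI Ix hx Ired a s hs; split=> [[[|n] [// _ has]]|has]; last first.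
  exists 1%N; split=> // z /(ipow1 _ hI) /has [y [Iy e]].
  by exists y; split=> //; apply/(ipow1 _ hI).
have powI w : ipow I n.+1 w -> colon_preimage I 1 (x ^+ n) w.
  elim: n {has} w => [|n IHn] w.
    by move/(ipow1 _ hI) => Iw; exists w; rewrite expr0.
  have hP := colon_preimage_ideal 1 (x ^+ n.+1) hI.
  rewrite [ipow _ _]/=; elim/ideal_mul_ind.
  - by case: hP.
  - by case: hP => _ [].
  move=> u v hu Iv.
  have [y [Iy]] := IHn u hu; rewrite mul1r => ->.
  have [z [Iz e]] := Ired v Iv y Iy.
  by exists z; split=> //; rewrite mul1r -mulrA [y * v]mulrC e exprSr mulrA.
move=> z Iz; have [w [hw e]] := has (x ^+ n * z) (ideal_mul_mem (ipowX n Ix) Iz).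
have [y [Iy]] := powI w hw; rewrite mul1r => ew; exists y; split=> //.
apply: (nonzerodivisor_cancel (nonzerodivisorX (n := n) hx)).
by rewrite mulrCA e ew mulrCA.
Qed.

Lemma stable_colonQ I x n y :
  regular_ideal I ->
  (forall y, (exists z, ipow I n z /\ y = x * z) <-> ipow I n.+1 y) ->
  stable I -> I y -> colonQ I y x.
Proof.
move=> rI hx sI Iy; apply/(sI _ _ (reduction_nonzerodivisor rI hx)).
by exists n.+1; split=> //; apply: reduction_colonQ.
Qed.

End IdealArithmetic.

(** * The integral closure of a principal ideal *)

Section IntegralClosure.
Import GRing.Theory.
Local Open Scope ring_scope.
Variable R : comNzRingType.
Implicit Types (I J K M : R -> Prop) (a b r s x y z : R).

(* [x \bar{R} \cap R], with [\bar{R}] the integral closure of [R] in [Q(R)]: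
   the integral closure of the ideal [(x)], and hence of every ideal having
   [x] as a principal reduction. *)
Definition principal_closure (x r : R) : Prop :=
  exists M, [/\ is_ideal M, regular_ideal M & colonQ M r x].

Lemma regular_ideal_mul I J :
  regular_ideal I -> regular_ideal J -> regular_ideal (ideal_mul I J).
Proof.
move=> [a [Ia ha]] [b [Jb hb]]; exists (a * b).
by split; [exact: ideal_mul_mem | exact: nonzerodivisorM].
Qed.

Lemma regular_ipow I n : regular_ideal I -> regular_ideal (ipow I n).
Proof.
by move=> [x [Ix hx]]; exists (x ^+ n); split; [exact: ipowX | exact: nonzerodivisorX].
Qed.

(** For sums: if [u / x] preserves [M] and [v / x] preserves [N], both preserve the regular ideal
    [M N]. *)
Lemma principal_closure_ideal x : is_ideal (principal_closure x).
Proof.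
have id1 : is_ideal (fun _ : R => True) by [].
have reg1 : regular_ideal (fun _ : R => True).
  by exists 1; split=> // y; rewrite mul1r.
split; first by exists (fun _ => True); split=> //; apply: colonQ0.
split=> [u v [M [hM rM uM]] [N [hN rN vN]]|c u [M [hM rM uM]]]; last first.
  by exists M; split=> //; apply: colonQ_scale.
have hMN := ideal_mul_ideal N hM.
exists (ideal_mul M N); split=> //; first exact: regular_ideal_mul.
by apply: colonQD => //; [exact: colonQ_mull | exact: colonQ_mulr].
Qed.

Lemma principal_closure_reduction I x n y :
  is_ideal I -> regular_ideal I ->
  (forall y, (exists z, ipow I n z /\ y = x * z) <-> ipow I n.+1 y) ->
  I y -> principal_closure x y.
Proof.
move=> hI rI hx Iy; exists (ipow I n.+1); split.
- exact: ipow_ideal.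
- exact: regular_ipow.
- exact: reduction_colonQ.
Qed.

(* As [R] is noetherian, one module [M] serves all elements of the closure. *)
Lemma principal_closure_uniform x : noetherian R ->
  exists M, [/\ is_ideal M, regular_ideal M &
    forall u, principal_closure x u -> colonQ M u x].
Proof.
move=> noeth; have hK := principal_closure_ideal x.
have [s hs] := noeth _ hK.
have Ks u : u \in s -> principal_closure x u.
  move=> us; have hi : (index u s < size s)%N by rewrite index_mem.
  apply/hs; exists (fun j => (j == Ordinal hi)%:R).
  rewrite (bigD1 (Ordinal hi)) //= eqxx mul1r nth_index // big1 ?addr0 //.
  by move=> j /negPf ->; rewrite mul0r.
suff [M [hM rM sM]] : exists M, [/\ is_ideal M, regular_ideal M &
    forall u, u \in s -> colonQ M u x].
  exists M; split=> // u /hs [c ->]; elim/big_ind: _ => [|a b|i _].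
  - exact: colonQ0.
  - exact: colonQD.
  - by apply: colonQ_scale => //; apply/sM/mem_nth.
elim: s Ks {hs} => [_|u s IHs Ks].
  by exists (fun _ => True); split=> //; exists 1; split=> // y; rewrite mul1r.
have [|M [hM rM sM]] := IHs; first by move=> v vs; apply: Ks; rewrite inE vs orbT.
have [N [hN rN uN]] := Ks u (mem_head u s).
exists (ideal_mul M N); split; [exact: ideal_mul_ideal|exact: regular_ideal_mul|].
move=> v; rewrite inE => /predU1P[->|/sM]; first exact: colonQ_mulr.
exact: colonQ_mull.
Qed.

Lemma colonQ_ipow K M x i a : is_ideal M ->
  (forall u, K u -> colonQ M u x) -> ipow K i a -> colonQ M a (x ^+ i).
Proof.
move=> hM KM; elim: i a => [|i IHi] a.
  by move=> _ y My; exists (a * y); split; [exact: idealM | rewrite mul1r].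
rewrite [ipow _ _]/=; elim/ideal_mul_ind => [|u v|u v hu Kv].
- exact: colonQ0.
- exact: colonQD.
by rewrite exprSr; apply: colonQM; [exact: IHi | exact: KM].
Qed.

(** Transitivity of integrality: dividing an equation of [r] over the closure by a power of [x]
    gives one for [r / x], whose coefficients [a i / x ^+ i] all preserve the uniform [M]. *)
Lemma principal_closure_integrally_closed x :
  noetherian R -> nonzerodivisor x ->
  integrally_closed_ideal (principal_closure x).
Proof.
move=> noeth hx r; have hK := principal_closure_ideal x; split=> [Kr|].
  exists 1%N, (fun=> - r); split=> //; split=> [i|].
    case: i => [|[|i]] // _; apply/(ipow1 _ hK).
    exact: idealN.
  by rewrite big_nat1 subnn expr0 mulr1 expr1 subrr.
case=> -[|n] [a [// _ [Ka ra]]].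
have [M [hM rM KM]] := principal_closure_uniform x noeth.
(* Generators of [x^n (M + (r/x) M + ... + (r/x)^n M)], an ideal of [R] that [r / x] preserves. *)
pose S t := exists m j, [/\ M m, (j <= n)%N & t = m * r ^+ j * x ^+ (n - j)].
have hS := ideal_span_ideal S.
exists (ideal_span S); split=> //.
  case: rM => m [Mm hm]; exists (m * x ^+ n).
  split; last by apply: nonzerodivisorM => //; apply: nonzerodivisorX.
  by apply: mem_ideal_span; exists m, 0%N; rewrite expr0 mulr1 subn0.
move=> t ht; apply: (ht (colon_preimage (ideal_span S) r x)).
  exact: colon_preimage_ideal.
move=> _ [m [j [Mm jn ->]]]; move: jn; rewrite leq_eqVlt => /predU1P[->|jn]; last first.
  exists (m * r ^+ j.+1 * x ^+ (n - j.+1)); split.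
    by apply: mem_ideal_span; exists m, j.+1.
  by rewrite -[(n - j)%N]subSS (subSn jn) !exprS; ring.
(* In top degree [j = n], the integral equation replaces [r ^+ n.+1] by lower powers of [r]. *)
rewrite subnn expr0 mulr1.
suff [y [hy e]] : colon_preimage (ideal_span S) 1 x (m * r ^+ n.+1).
  by exists y; split=> //; rewrite -e mul1r exprS; ring.
have -> : r ^+ n.+1 = - \sum_(1 <= i < n.+2) a i * r ^+ (n.+1 - i).
  by apply/eqP; rewrite -addr_eq0 ra.
have hP := colon_preimage_ideal 1 x hS.
rewrite mulrN mulr_sumr; apply: idealN => //.
rewrite big_seq; apply: ideal_sum => // -[|i]; rewrite mem_index_iota // ltnS => hi.
have [y [My e]] := colonQ_ipow hM KM (Ka i.+1 hi) Mm.
exists (y * r ^+ (n - i) * x ^+ (n - (n - i))); split.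
  by apply: mem_ideal_span; exists y, (n - i)%N; rewrite leq_subr.
by rewrite subKn // subSS mul1r mulrCA mulrA e exprS; ring.
Qed.

End IntegralClosure.

(** * Trace ideals, and the trace of an ideal viewed as a module *)

Section TraceIdeals.
Import GRing.Theory.
Local Open Scope ring_scope.
Variable R : comNzRingType.
Implicit Types (I J K M : R -> Prop) (a b r s x y z : R).

(* The homomorphism [(a / g) phi : N -> R]. *)
Lemma linear_fraction (N : lmodType R) (phi : {linear N -> R^o}) a g :
  nonzerodivisor g -> (forall n, exists t, g * t = a * phi n) ->
  exists psi : {linear N -> R^o}, forall n, g * (psi n : R) = a * phi n.
Proof.
move=> hg ex; have exb n : exists t, g * t == a * phi n.
  by have [t e] := ex n; exists t; rewrite e.
pose f n : R^o := xchoose (exb n).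
have fE n : g * (f n : R) = a * phi n by apply/eqP/(xchooseP (exb n)).
(* Quotients by [g] are unique, so the chosen ones depend linearly on [n]. *)
have lin : linear f.
  move=> c u v; apply: (nonzerodivisor_cancel hg).
  rewrite fE linearP [RHS]mulrDr [g * (c *: f u)]mulrCA !fE -[c *: phi u]/(c * phi u).
  by ring.
exists (HB.pack_for {linear N -> R^o} f (GRing.isLinear.Build R N R^o _ f lin)).
exact: fE.
Qed.

Lemma trace_of_mem (N : lmodType R) (phi : {linear N -> R^o}) n :
  trace_of N (phi n : R).
Proof. by exists [:: (n, phi)]; rewrite big_seq1. Qed.

Lemma trace_ofD (N : lmodType R) x y :
  trace_of N x -> trace_of N y -> trace_of N (x + y).
Proof. by move=> [s ->] [t ->]; exists (s ++ t); rewrite big_cat. Qed.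

Lemma trace_of0 (N : lmodType R) : trace_of N 0.
Proof. by exists [::]; rewrite big_nil. Qed.

Lemma trace_of_ind (N : lmodType R) (P : R -> Prop) t :
  P 0 -> (forall x y, P x -> P y -> P (x + y)) ->
  (forall (phi : {linear N -> R^o}) n, P (phi n)) ->
  trace_of N t -> P t.
Proof. by move=> P0 PD PM [s ->]; elim/big_ind: _. Qed.

Lemma trace_of_ideal (N : lmodType R) : is_ideal (trace_of N).
Proof.
split; first exact: trace_of0.
split=> [x y|r x]; first exact: trace_ofD.
elim/trace_of_ind => [|u v hu hv|phi n].
- by rewrite mulr0; apply: trace_of0.
- by rewrite mulrDr; apply: trace_ofD.
by rewrite -[r * _]/(r *: (phi n)) -linearZ; apply: trace_of_mem.
Qed.

(* If [y J] is contained in [x R], then multiplication by [y / x] maps [J]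
   to [R], and postcomposition with it preserves the trace. *)
Lemma trace_ideal_colonQ J x y :
  trace_ideal J -> nonzerodivisor x ->
  (forall z, J z -> exists t, y * z = x * t) -> colonQ J y x.
Proof.
move=> [N JN] hx hy z /JN; elim/trace_of_ind => [|u v [a [Ja ea]] [b [Jb eb]]|phi n].
- by exists 0; rewrite !mulr0; split=> //; apply/JN/trace_of0.
- by exists (a + b); rewrite !mulrDr ea eb; split=> //; apply/JN/trace_ofD; apply/JN.
have [|psi psiE] := @linear_fraction N phi y x hx.
  by move=> m; have [|t ->] := hy (phi m); [apply/JN/trace_of_mem | exists t].
by exists (psi n); rewrite psiE; split=> //; apply/JN/trace_of_mem.
Qed.

(** Membership is made boolean classically; the argument [hI] lets the submodule structure be
    inferred from the predicate. *)
Definition ideal_pred I (hI : is_ideal I) : {pred R^o} := fun x => `[< I x >].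

Lemma ideal_pred_submod_closed I (hI : is_ideal I) :
  GRing.submod_closed (ideal_pred hI).
Proof.
have [I0 [ID _]] := hI; split=> [|c u v /asboolP Iu /asboolP Iv]; first exact/asboolP.
by apply/asboolP/ID => //; apply: idealM.
Qed.

HB.instance Definition _ I (hI : is_ideal I) :=
  GRing.isSubmodClosed.Build R R^o (ideal_pred hI) (ideal_pred_submod_closed hI).

Definition ideal_module I (hI : is_ideal I) := {x : R^o | x \in ideal_pred hI}.

HB.instance Definition _ I (hI : is_ideal I) := SubChoice.on (ideal_module hI).
HB.instance Definition _ I (hI : is_ideal I) :=
  [SubChoice_isSubLmodule of ideal_module hI by <:].

Section IdealModule.
Variables (I : R -> Prop) (hI : is_ideal I) (g : R).
Hypotheses (Ig : I g) (hg : nonzerodivisor g).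
Local Notation N := (ideal_module hI : lmodType R).

Let F (f : R) : Prop := forall i, I i -> exists t, g * t = f * i.

Let mem_ideal (u : N) : I (val u).
Proof. exact/asboolP/(valP u). Qed.

Let to_module i (Ii : I i) : exists u : N, val u = i.
Proof.
have h : (i : R^o) \in ideal_pred hI by apply/asboolP.
by exists (exist _ i h).
Qed.

Let val_linear : {linear N -> R^o} := val.

Lemma sub_trace_of_ideal_module i : I i -> trace_of N i.
Proof. by case/to_module=> u <-; apply: (@trace_of_mem N val_linear). Qed.

(* [F = g (R :_Q I)], hence [g tr(I) = I F]. *)
Let mul_trace r : trace_of N r -> ideal_mul I F (g * r).
Proof.
elim/trace_of_ind => [|u v hu hv|phi n].
- by rewrite mulr0; apply: ideal_mul0.
- by rewrite mulrDr; apply: ideal_mulD.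
have [u ug] := to_module Ig.
(* Both sides are [phi (g m)]: every map [phi] is multiplication by the fraction [phi u / g]. *)
have swap (m : N) : g * phi m = val m * phi u.
  have -> : g * phi m = phi (g *: m) by rewrite linearZ.
  have -> : val m * phi u = phi ((val m : R) *: u) by rewrite linearZ.
  congr (phi _); apply: val_inj; rewrite !linearZ /= ug.
  by rewrite -[LHS]/(g * val m) -[RHS]/(val m * g) mulrC.
rewrite swap; apply: ideal_mul_mem; first exact: mem_ideal.
move=> i /to_module [w <-]; exists (phi w).
by rewrite swap mulrC.
Qed.

Let mul_trace_inv t : ideal_mul I F t -> exists r, trace_of N r /\ t = g * r.
Proof.
elim/ideal_mul_ind => [|u v [a [ha ->]] [b [hb ->]]|i f Ii Ff].
- by exists 0; rewrite mulr0; split=> //; apply: trace_of0.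
- by exists (a + b); rewrite mulrDr; split=> //; apply: trace_ofD.
have [|psi psiE] := @linear_fraction N val_linear f g hg.
  by move=> u; apply: Ff; apply: mem_ideal.
have [u <-] := to_module Ii; exists (psi u).
by rewrite psiE mulrC; split=> //; apply: trace_of_mem.
Qed.

Let mul_ipow_trace m r :
  ipow (trace_of N) m r -> ideal_mul (ipow I m) (ipow F m) (g ^+ m * r).
Proof.
elim: m r => [|m IHm] r.
  by move=> _; rewrite expr0; apply: ideal_mul_mem.
rewrite [ipow (trace_of _) _]/=; elim/ideal_mul_ind => [|u v hu hv|u v hu hv].
- by rewrite mulr0; apply: ideal_mul0.
- by rewrite mulrDr; apply: ideal_mulD.
rewrite exprSr mulrACA; apply: ideal_mulACA; apply: ideal_mul_mem.
  exact: IHm.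
exact: mul_trace.
Qed.

Let mul_ipow_trace_inv m t : ideal_mul (ipow I m) (ipow F m) t ->
  exists r, ipow (trace_of N) m r /\ t = g ^+ m * r.
Proof.
elim: m t => [|m IHm] t; first by exists t; rewrite expr0 mul1r.
move/ideal_mulACA; elim/ideal_mul_ind => [|u v [a [ha ->]] [b [hb ->]]|u v].
- by exists 0; rewrite mulr0; split=> //; apply: ideal_mul0.
- by exists (a + b); rewrite mulrDr; split=> //; apply: ideal_mulD.
move=> /IHm [a [ha ->]] /mul_trace_inv [b [hb ->]]; exists (a * b).
by rewrite exprSr mulrACA; split=> //; apply: ideal_mul_mem.
Qed.

(** As [g^m tr(I)^m = I^m F^m], the fraction acts through the factor [I^m]; then [g^m] cancels. *)
Lemma colonQ_ipow_trace m y x :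
  colonQ (ipow I m) y x -> colonQ (ipow (trace_of N) m) y x.
Proof.
move=> hyx a /mul_ipow_trace ha.
have [c [/mul_ipow_trace_inv [b [hb ->]] e]] := colonQ_mull hyx ha.
exists b; split=> //.
apply: (nonzerodivisor_cancel (nonzerodivisorX (n := m) hg)).
by rewrite mulrCA e mulrCA.
Qed.

End IdealModule.
End TraceIdeals.

(** * The two implications *)

Section Equivalence.
Import GRing.Theory.
Local Open Scope ring_scope.
Variable R : comNzRingType.
Implicit Types (I J K M : R -> Prop) (a b r s x y z : R).
Hypotheses (noeth : noetherian R)
  (red : forall I, is_ideal I -> regular_ideal I -> has_principal_reduction I).

Lemma stable_integrally_closed I :
  (forall J, is_ideal J -> trace_ideal J -> regular_ideal J -> stable J) ->
  is_ideal I -> integrally_closed_ideal I -> regular_ideal I -> stable I.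
Proof.
move=> trace_stable hI icI rI; have [x [Ix [n hx]]] := red hI rI.
have nx := reduction_nonzerodivisor rI hx.
apply: (stable_of_reduction hI Ix nx) => y Iy z Iz.
have [g [Ig hg]] := rI.
pose J := trace_of (ideal_module hI).
have hJ : is_ideal J by apply: trace_of_ideal.
have IJ i : I i -> J i by apply: sub_trace_of_ideal_module.
have sJ : stable J.
  apply: trace_stable => //; first by exists (ideal_module hI).
  by exists g; split=> //; apply: IJ.
have Jyx : colonQ J y x.
  apply/(sJ _ _ nx); exists n.+1; split=> //.
  by apply: (colonQ_ipow_trace Ig hg); apply: reduction_colonQ.
have [t [_ e]] := Jyx z (IJ z Iz); exists t; split=> //; apply/icI.
(* [t / x = (y / x) (z / x)], and both factors preserve [I^(n+1)]. Hence [t / x] is integral over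
   [R], and clearing denominators gives coefficients [c i * x ^+ i] in [I^i]. *)
have tx : colonQ (ipow I n.+1) t x.
  move=> a ha; have [b [hb eb]] := reduction_colonQ hx Iy ha.
  have [c [hc ec]] := reduction_colonQ hx Iz hb.
  exists c; split=> //; rewrite -ec; apply: (nonzerodivisor_cancel nx).
  by rewrite mulrA -e [y * z]mulrC -mulrA eb mulrCA.
have [k [c [k0 kE]]] :=
  colonQ_integral_equation noeth (ipow_ideal n.+1 hI) (regular_ipow n.+1 rI) tx.
exists k, (fun i => c i * x ^+ i); split=> //; split=> // i _.
by apply: idealM; [exact: ipow_ideal | exact: ipowX].
Qed.

Lemma Arf_stable_trace J :
  Arf R -> is_ideal J -> trace_ideal J -> regular_ideal J -> stable J.
Proof.
move=> arf hJ tJ rJ; have [x [Jx [n hx]]] := red hJ rJ.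
have nx := reduction_nonzerodivisor rJ hx.
apply: (stable_of_reduction hJ Jx nx) => y Jy.
apply: (trace_ideal_colonQ tJ nx) => z Jz.
pose K := principal_closure x.
have JK i : J i -> K i by apply: principal_closure_reduction hx.
have hK : is_ideal K := principal_closure_ideal x.
have rK : regular_ideal K by exists x; split=> //; apply: JK.
have [w [Kw [m hw]]] := red hK rK.
have nw := reduction_nonzerodivisor rK hw.
have sK : stable K.
  by apply: arf => //; apply: principal_closure_integrally_closed.
have Kred u : K u -> colonQ K u w := stable_colonQ rK hw sK.
(* By [K K = w K], [y z = w u] with [u] in [K]; it remains to divide [w u] by [x]. *)
have [u [Ku ->]] := Kred y (JK y Jy) z (JK z Jz).
(* [w K] is contained in [x K]: cancel [w ^+ k] in the equation of [w], which
   has coefficients in the powers of [(x)]; all products of elements of [K]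
   simplify by [K K = w K]. *)
have [M [hM rM wM]] := Kw.
have [[|k] [c [// _ kE]]] := colonQ_integral_equation noeth hM rM wM.
have xK i v : K v -> exists v', K v' /\ x ^+ i * v = w ^+ i * v'.
  elim: i v => [|i IHi] v Kv; first by exists v; rewrite !expr0.
  have [a [Ka ea]] := Kred x (JK x Jx) v Kv; have [b [Kb eb]] := IHi a Ka.
  by exists b; split=> //; rewrite exprSr -mulrA ea mulrCA eb exprS mulrA.
suff [v [_ e]] : colon_preimage K 1 (x * w ^+ k) (w ^+ k.+1 * u).
  exists v; apply: (nonzerodivisor_cancel (nonzerodivisorX (n := k) nw)).
  by rewrite mulrA -exprSr -[LHS]mul1r e mulrCA mulrA.
have -> : w ^+ k.+1 = - \sum_(1 <= i < k.+2) c i * x ^+ i * w ^+ (k.+1 - i).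
  by apply/eqP; rewrite -addr_eq0 kE.
have hP := colon_preimage_ideal 1 (x * w ^+ k) hK.
rewrite mulNr mulr_suml; apply: idealN => //.
rewrite big_seq; apply: ideal_sum => // -[|i]; rewrite mem_index_iota // ltnS => hi.
(* Only [x ^+ i] is traded for [w ^+ i], keeping one factor [x] of [x ^+ i.+1]; with [w ^+ (k - i)]
   this makes up [x * w ^+ k]. *)
have [v [Kv ev]] := xK i u Ku.
exists (c i.+1 * v); split; first exact: idealM.
have ik : (i <= k)%N by move: hi.
rewrite subSS mul1r -{2}(subnK ik) exprD exprS.
transitivity (c i.+1 * x * w ^+ (k - i) * (x ^+ i * u)); first by ring.
by rewrite ev; ring.
Qed.

End Equivalence.

Theorem theorem7p4 (R : comNzRingType) :
  cohen_macaulay_local R -> krull_dim R 1 ->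
  (forall I : R -> Prop, is_ideal I -> regular_ideal I -> has_principal_reduction I) ->
  (Arf R <->
   (forall I : R -> Prop, is_ideal I -> trace_ideal I -> regular_ideal I -> stable I)).
Proof.
move=> [noeth _] _ red; split=> [arf J|trace_stable I hI icI rI].
  exact: Arf_stable_trace.
exact: stable_integrally_closed.
Qed.
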